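(* Let $V=\mathbb{F}_2^6$ with coordinate ring $\mathbb{F}_2[V]=\mathbb{F}_2[x_{12},x_{13},x_{14},x_{23},x_{24},x_{34}]$ and the action of the symmetric group $\mathcal{S}_4$ described in the context, and let $M=\{f_1,\ldots,f_{10}\}\subset\mathbb{F}_2[V]^{\mathcal{S}_4}$, where \begin{align*} &f_1=o(x_{12}),\quad f_2=o(x_{12}x_{13}),\quad f_3=o(x_{12}x_{34}),\\ &f_4=o(x_{12}x_{13}x_{14}),\quad f_5=o(x_{12}x_{13}x_{23}),\quad f_6=o(x_{12}x_{13}x_{24}),\\ &f_7=o(x_{12}x_{13}x_{14}x_{24}),\quad f_8=o(x_{12}x_{13}x_{24}x_{34}),\quad f_9=o(x_{12}x_{13}x_{14}x_{23}x_{24}),\\ &f_{10}=o(x_{12}x_{13}x_{14}x_{23}x_{24}x_{34})=x_{12}x_{13}x_{14}x_{23}x_{24}x_{34}. \end{align*} Then the subsets $S_1=\{f_1,f_2,f_3,f_4,f_8\}$ and $S_2=\{f_1,f_2,f_3,f_5,f_8\}$ are the only minimal (with respect to inclusion) separating subsets of $M$. Moreover, $S_3=\{f_1,f_2,f_3,f_4+f_8\}$ and $S_4=\{f_1,f_2,f_3,f_5+f_8\}$ are separating sets for $\mathbb{F}_2[V]^{\mathcal{S}_4}$ of the smallest possible size. In particular, $\beta_{\rm sep}(\mathbb{F}_2[V]^{\mathcal{S}_4})=4$.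
   Context: The group $\mathcal{S}_4$ acts on the two-element subsets of $\{1,2,3,4\}$ by $\sigma\cdot\{i,j\}=\{\sigma(i),\sigma(j)\}$. This gives a permutation representation $V=\mathbb{F}_2^{6}$, with coordinates indexed by the two-element subsets, and $\mathcal{S}_4$ acts on $\mathbb{F}_2[V]=\mathbb{F}_2[x_{ij}\mid 1\le i<j\le 4]$ by algebra automorphisms permuting the variables, $\sigma\cdot x_{\{i,j\}}=x_{\{\sigma(i),\sigma(j)\}}$ with $x_{ij}=x_{\{i,j\}}$. (Points of $V$ correspond to simple graphs on 4 vertices, orbits to isomorphism classes.) $\mathbb{F}_2[V]^{\mathcal{S}_4}$ is the ring of invariant polynomials. For $f\in\mathbb{F}_2[V]$, $o(f)$ denotes the sum of the (distinct) elements of the $\mathcal{S}_4$-orbit of $f$. Elements $u,v\in V$ are separated by a set $S$ of invariants if $f(u)\ne f(v)$ for some $f\in S$. A subset $S$ of the invariant ring is separating if any $u,v\in V$ that can be separated by the whole invariant ring can also be separated by $S$. $\beta_{\rm sep}(\mathbb{F}_2[V]^{\mathcal{S}_4})$ is the minimal integer $\beta$ such that the set of all homogeneous invariants of degree $\le\beta$ is separating. *)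

(* Defs.v *)
From mathcomp Require Import all_boot all_order all_fingroup all_algebra.
From mathcomp Require Import finmap.
From mathcomp Require Import mpoly.
Set Implicit Arguments.
Unset Strict Implicit.
Unset Printing Implicit Defensive.
Import GRing.Theory.
Local Open Scope ring_scope.

Notation edge := {e : {set 'I_4} | #|e| == 2%N}.

Notation graph := {ffun edge -> 'F_2}.

(* The variables are numbered along the enumeration of [edge]; the numbering
   is hidden behind [xvar] and [evalg]. *)
Notation gpoly := {mpoly 'F_2[#|{: edge}|]}.

Definition xvar (e : edge) : gpoly := 'X_(enum_rank e).

Definition evalg (f : gpoly) (v : graph) : 'F_2 := f.@[fun i => v (enum_val i)].

Fact edge_act_subproof (s : 'S_4) (e : edge) : #|s @: val e| == 2%N.
Proof. by rewrite card_imset ?(valP e) //; exact: perm_inj. Qed.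

Definition edge_act (s : 'S_4) (e : edge) : edge :=
  Sub (s @: val e) (edge_act_subproof s e).

(* MathComp composes permutations left to right, so this is a right action;
   its orbits and invariants are those of the corresponding left action. *)
Definition poly_act (s : 'S_4) (f : gpoly) : gpoly :=
  f \mPo [tuple xvar (edge_act s (enum_val i)) | i < #|{: edge}|].

Definition invariant_ring : {pred gpoly} :=
  [pred f | [forall s : 'S_4, poly_act s f == f]].

Definition orbit_sum (f : gpoly) : gpoly :=
  \sum_(g <- undup [seq poly_act s f | s : 'S_4]) g.

Definition separated (S : {pred gpoly}) (u v : graph) : Prop :=
  exists2 f, f \in S & evalg f u != evalg f v.

Definition separating (S : {pred gpoly}) : Prop :=
  {subset S <= invariant_ring} /\
  forall u v : graph, separated invariant_ring u v -> separated S u v.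

Definition minimal_separating_subset (M S : {fset gpoly}) : Prop :=
  [/\ (S `<=` M)%fset, separating (mem S) &
      forall T : {fset gpoly}, (T `<` S)%fset -> ~ separating (mem T)].

(* Only finite competitors [T] matter: [S] is finite, hence smaller than any
   infinite set. *)
Definition smallest_separating (S : {fset gpoly}) : Prop :=
  separating (mem S) /\
  forall T : {fset gpoly}, separating (mem T) -> (#|` S| <= #|` T|)%N.

Definition homog_invariant_le (b : nat) : {pred gpoly} :=
  [pred f | (f \in invariant_ring) && [exists d : 'I_b.+1, f \is d.-homog]].

Definition is_beta_sep (b : nat) : Prop :=
  separating (homog_invariant_le b) /\
  forall b' : nat, separating (homog_invariant_le b') -> (b <= b')%N.

Fact mk_edge_subproof (i j : 'I_4) : i != j -> #|[set i; j]| == 2%N.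
Proof. by move=> ij; rewrite cards2 ij. Qed.

Definition mk_edge (i j : 'I_4) (ij : i != j) : edge :=
  Sub [set i; j] (mk_edge_subproof ij).

(* The vertices 1, 2, 3, 4 are the elements 0, 1, 2, 3 of ['I_4]. *)
Definition v1 : 'I_4 := @Ordinal 4 0 isT.
Definition v2 : 'I_4 := @Ordinal 4 1 isT.
Definition v3 : 'I_4 := @Ordinal 4 2 isT.
Definition v4 : 'I_4 := @Ordinal 4 3 isT.

Definition x12 : gpoly := xvar (@mk_edge v1 v2 isT).
Definition x13 : gpoly := xvar (@mk_edge v1 v3 isT).
Definition x14 : gpoly := xvar (@mk_edge v1 v4 isT).
Definition x23 : gpoly := xvar (@mk_edge v2 v3 isT).
Definition x24 : gpoly := xvar (@mk_edge v2 v4 isT).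
Definition x34 : gpoly := xvar (@mk_edge v3 v4 isT).

Definition f1 : gpoly := orbit_sum x12.
Definition f2 : gpoly := orbit_sum (x12 * x13).
Definition f3 : gpoly := orbit_sum (x12 * x34).
Definition f4 : gpoly := orbit_sum (x12 * x13 * x14).
Definition f5 : gpoly := orbit_sum (x12 * x13 * x23).
Definition f6 : gpoly := orbit_sum (x12 * x13 * x24).
Definition f7 : gpoly := orbit_sum (x12 * x13 * x14 * x24).
Definition f8 : gpoly := orbit_sum (x12 * x13 * x24 * x34).
Definition f9 : gpoly := orbit_sum (x12 * x13 * x14 * x23 * x24).
Definition f10 : gpoly := orbit_sum (x12 * x13 * x14 * x23 * x24 * x34).

Definition M : {fset gpoly} := [fset f1; f2; f3; f4; f5; f6; f7; f8; f9; f10]%fset.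
Definition S1 : {fset gpoly} := [fset f1; f2; f3; f4; f8]%fset.
Definition S2 : {fset gpoly} := [fset f1; f2; f3; f5; f8]%fset.
Definition S3 : {fset gpoly} := [fset f1; f2; f3; (f4 + f8)%R]%fset.
Definition S4 : {fset gpoly} := [fset f1; f2; f3; (f5 + f8)%R]%fset.

(* Main.v *)
(* Over F_2 the orbit sum of the squarefree monomial with edge set E takes at a
   graph G the parity of the number of subgraphs of G isomorphic to E. Tabulating
   these parities on the 11 isomorphism classes of graphs shows which sets of
   orbit sums separate, and exhibits, for each of f1, f2, f3, f8 and for the pair
   {f4, f5}, two classes that no other element of M tells apart. Four invariants
   are needed because 2 ^ 3 < 11. In degree at most 3, an invariant sums to 0 over
   the 16 subgraphs of a 4-cycle, while the isomorphism classes of the proper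
   nonempty subgraphs have even size there; hence it agrees on the empty graph and
   on the 4-cycle, which f8 separates. *)
Require Import Defs.
From mathcomp Require Import all_boot all_order all_fingroup all_algebra.
From mathcomp Require Import finmap.
From mathcomp Require Import mpoly.
Set Implicit Arguments.
Unset Strict Implicit.
Unset Printing Implicit Defensive.
Import GRing.Theory.
Local Open Scope ring_scope.

(** * Edges as ranks below 6 and permutations as words *)

Definition edges : seq edge :=
  [:: @mk_edge v1 v2 isT; @mk_edge v1 v3 isT; @mk_edge v1 v4 isT;
      @mk_edge v2 v3 isT; @mk_edge v2 v4 isT; @mk_edge v3 v4 isT].

Definition edge_nth (i : nat) : edge := nth (@mk_edge v1 v2 isT) edges i.

(** Endpoints as plain naturals, in the order of [edges], so that later finite checks run by
    [vm_compute] without meeting finite types. *)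
Definition ends : seq (nat * nat) :=
  [:: (0, 1); (0, 2); (0, 3); (1, 2); (1, 3); (2, 3)]%N.

(** Both orders of the endpoints are accepted, since a permutation may reverse them. *)
Definition edge_rank (a b : nat) : nat :=
  find (fun q => (q == (a, b)) || (q == (b, a))) ends.

Definition perm_code (s : 'S_4) : seq nat :=
  [seq val (s k) | k <- [:: v1; v2; v3; v4]].

Definition edge_perm (t : seq nat) : seq nat :=
  [seq edge_rank (nth 0 t p.1) (nth 0 t p.2) | p <- ends]%N.

Definition edge_perms := [seq edge_perm t | t <- permutations (iota 0 4)].

Lemma mk_edgeE (a b : 'I_4) (ab : a != b) :
  mk_edge ab = edge_nth (edge_rank a b) /\ (edge_rank a b < 6)%N.
Proof.
case: a b ab => [[|[|[|[|//]]]] pa] [[|[|[|[|//]]]] pb] ab //; split => //;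
  apply/val_inj/setP => k; rewrite /= !inE -!val_eqE //=; exact: orbC.
Qed.

Lemma edge_nthP (e : edge) : exists2 i, (i < 6)%N & e = edge_nth i.
Proof.
have /cards2P[a [b [ab eab]]] := valP e.
have [E lt6] := mk_edgeE ab; exists (edge_rank a b) => //.
by rewrite -E; apply: val_inj.
Qed.

Lemma edge_rankK i : (i < 6)%N ->
  exists (a b : 'I_4) (ab : a != b),
    [/\ nth (0, 0)%N ends i = (val a, val b) & edge_nth i = mk_edge ab].
Proof.
by case: i => [|[|[|[|[|[|//]]]]]] _;
  [exists v1, v2|exists v1, v3|exists v1, v4|exists v2, v3|exists v2, v4
  |exists v3, v4]; exists isT.
Qed.

Lemma uniq_edges : uniq edges.
Proof.
(* The incidence bits of the four vertices turn distinctness of sets into distinctness of bit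
   lists. *)
pose h (e : edge) := [seq k \in val e | k <- [:: v1; v2; v3; v4]].
by apply: (@map_uniq _ _ h); rewrite /h /= !inE.
Qed.

Lemma mem_edges e : e \in edges.
Proof. by have [i lt6 ->] := edge_nthP e; apply: mem_nth. Qed.

Lemma nth_perm_code s (a : 'I_4) : nth 0%N (perm_code s) a = s a.
Proof.
by case: a => [[|[|[|[|//]]]] pa] /=; congr (val (s _)); apply: val_inj.
Qed.

Lemma edge_act_nth s i : (i < 6)%N ->
  edge_act s (edge_nth i) = edge_nth (nth 0%N (edge_perm (perm_code s)) i).
Proof.
move=> lt6; have [a [b [ab [Ei ->]]]] := edge_rankK lt6.
rewrite (nth_map (0, 0)%N) // Ei /= !nth_perm_code.
have sab : s a != s b by rewrite (inj_eq perm_inj).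
have [<- _] := mk_edgeE sab.
by apply: val_inj; rewrite /= imsetU1 imset_set1.
Qed.

(** A rearrangement of 0, 1, 2, 3 is duplicate-free with entries below 4, so it is the value list of
    an injective self-map of ['I_4]. Quantifying over the symmetric group thus becomes a check on 24
    explicit words. *)
Lemma perm_codeP t :
  reflect (exists s, t = perm_code s) (t \in permutations (iota 0 4)).
Proof.
rewrite mem_permutations; apply: (iffP idP) => [tP | [s ->]].
- have sz : size t = 4%N by rewrite (perm_size tP).
  have t_lt (k : 'I_4) : (nth 0%N t k < 4)%N.
    have : nth 0%N t k \in t by rewrite mem_nth ?sz.
    by rewrite (perm_mem tP) mem_iota.
  have inj : injective (fun k => Ordinal (t_lt k)).
    move=> j k [] /eqP; rewrite nth_uniq ?sz //; first by move/eqP/val_inj.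
    by rewrite (perm_uniq tP).
  exists (perm inj); apply: (@eq_from_nth _ 0%N) => // i; rewrite sz => lti.
  by rewrite -[i]/(val (Ordinal lti)) nth_perm_code permE.
- apply: uniq_perm; rewrite ?iota_uniq //.
    by rewrite map_inj_uniq //; apply: inj_comp val_inj perm_inj.
  move=> x; rewrite mem_iota; apply/mapP/idP => [[k _ ->]|ltx].
    exact: ltn_ord.
  exists ((s^-1)%g (Ordinal ltx : 'I_4)); last by rewrite permKV.
  by case: ((s^-1)%g _) => [[|[|[|[|//]]]] pk].
Qed.

Lemma edge_permsP p :
  reflect (exists s, p = edge_perm (perm_code s)) (p \in edge_perms).
Proof.
apply: (iffP mapP) => [[t /perm_codeP[s ->] ->] | [s ->]]; first by exists s.
by exists (perm_code s) => //; apply/perm_codeP; exists s.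
Qed.

Lemma edge_perms_perm p : p \in edge_perms -> perm_eq p (iota 0 6).
Proof. by move: p; apply/allP. Qed.

(* Edge sets (of graphs and of squarefree monomials) are encoded by 6 bits along
   [ends]. [act_graph] takes the preimage under the edge permutation [p], and
   [act_mon] the image. *)
Definition act_graph (p : seq nat) (b : bitseq) : bitseq := map (nth false b) p.

Definition act_mon (p : seq nat) (a : bitseq) : bitseq :=
  [seq nth false a (index j p) | j <- iota 0 6].

Definition bitseqs (n : nat) : seq bitseq :=
  iter n (fun l => [seq c :: b | c <- [:: false; true], b <- l]) [:: [::]].

Lemma mem_bitseqs n b : (b \in bitseqs n) = (size b == n).
Proof.
elim: n b => [|n IHn] b; first by rewrite inE size_eq0.
rewrite [bitseqs _]iterS; apply/allpairsP/idP => [[[c b'] /= [_ b'P ->]] | ].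
  by rewrite eqSS -IHn.
case: b => [|c b] //; rewrite eqSS -IHn => bP.
by exists (c, b); split => //; case: c.
Qed.

Definition codes : seq bitseq := bitseqs 6.

(** * Monomials and graphs attached to codes, and the action on them *)

Definition mon (a : bitseq) : gpoly :=
  \prod_(i <- iota 0 6) xvar (edge_nth i) ^+ nth false a i.

Definition graph_of (b : bitseq) : graph :=
  [ffun e => (nth false b (index e edges))%:R].

Lemma graph_of_nth b i : (i < 6)%N -> graph_of b (edge_nth i) = (nth false b i)%:R.
Proof. by move=> lt6; rewrite ffunE index_uniq // uniq_edges. Qed.

Lemma graph_ofP (v : graph) : exists2 b, b \in codes & v = graph_of b.
Proof.
exists [seq v e != 0 | e <- edges]; first by rewrite mem_bitseqs.
apply/ffunP => e; have [i lt6 ->] := edge_nthP e.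
rewrite graph_of_nth // (nth_map (edge_nth 0)) // -/(edge_nth i).
by case: (v (edge_nth i)) => [[|[|//]] lt2]; apply: val_inj.
Qed.

Definition subcode (a b : bitseq) : bool :=
  all (fun i => nth false a i ==> nth false b i) (iota 0 6).

Lemma evalg_xvar e v : evalg (xvar e) v = v e.
Proof. by rewrite /evalg /xvar mevalXU enum_rankK. Qed.

Lemma prod_bool_exp (R : pzRingType) (I : Type) (r : seq I) (x y : I -> bool) :
  \prod_(i <- r) (x i)%:R ^+ y i = (all (fun i => y i ==> x i) r)%:R :> R.
Proof.
elim: r => [|i r IHr]; first by rewrite big_nil.
by rewrite big_cons IHr /=; case: (x i) (y i) => [] []; rewrite ?(mul1r, mul0r).
Qed.

Lemma evalg_mon a b : evalg (mon a) (graph_of b) = (subcode a b)%:R.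
Proof.
rewrite -prod_bool_exp /evalg rmorph_prod.
apply: eq_big_seq => i; rewrite mem_iota => lt6.
by rewrite rmorphXn /= -/(evalg _ _) evalg_xvar graph_of_nth.
Qed.

Lemma F2_bool_inj (b c : bool) : b%:R = c%:R :> 'F_2 -> b = c.
Proof. by case: b c => [] []. Qed.

Lemma subcode_anti a b :
  a \in codes -> b \in codes -> subcode a b -> subcode b a -> a = b.
Proof.
rewrite !mem_bitseqs => /eqP sa /eqP sb /allP ab /allP ba.
apply: (@eq_from_nth _ false) => [|i]; rewrite sa // => lt6.
have i6 : i \in iota 0 6 by rewrite mem_iota.
by apply/idP/idP; [apply/implyP/ab | apply/implyP/ba].
Qed.

Lemma subcode_refl a : subcode a a.
Proof. by apply/allP => i _; apply: implybb. Qed.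

(** Evaluating both monomials at the graphs of [a] and of [b] gives inclusion of the codes in both
    directions. *)
Lemma mon_inj : {in codes &, injective mon}.
Proof.
move=> a b ca cb eab; apply: subcode_anti => //; apply: F2_bool_inj.
  by rewrite -evalg_mon eab evalg_mon subcode_refl.
by rewrite -evalg_mon -eab evalg_mon subcode_refl.
Qed.

Lemma poly_act_xvar s e : poly_act s (xvar e) = xvar (edge_act s e).
Proof.
by rewrite /poly_act /xvar comp_mpolyXU -tnth_nth tnth_mktuple enum_rankK.
Qed.

Lemma poly_act_mon s a :
  poly_act s (mon a) = mon (act_mon (edge_perm (perm_code s)) a).
Proof.
set p := edge_perm _.
have pP : perm_eq p (iota 0 6) by apply/edge_perms_perm/edge_permsP; exists s.
rewrite /mon /poly_act rmorph_prod -[RHS](perm_big _ pP).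
have szp : size p = 6%N := perm_size pP.
have def_p : [seq nth 0%N p i | i <- iota 0 6] = p.
  by rewrite -szp; exact: (mkseq_nth 0%N p).
(* With the target product indexed along [p], its factor at position [i] carries the exponent at
   [index (nth 0 p i) p], which is [i] because [p] has no duplicates. *)
rewrite -{1}def_p big_map; apply: eq_big_seq => i; rewrite mem_iota => lt6.
rewrite rmorphXn /= -/(poly_act s _) poly_act_xvar edge_act_nth // -/p.
have lt6' : (nth 0%N p i < 6)%N.
  have : nth 0%N p i \in p by rewrite mem_nth ?szp.
  by rewrite (perm_mem pP) mem_iota.
by rewrite (nth_map 0%N) ?size_iota // nth_iota // index_uniq ?szp ?(perm_uniq pP).
Qed.

Lemma evalg_poly_act s f v :
  evalg (poly_act s f) v = evalg f [ffun e => v (edge_act s e)].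
Proof.
rewrite /evalg comp_mpoly_meval; apply: meval_eq => i.
by rewrite tnth_mktuple -/(evalg _ _) evalg_xvar ffunE.
Qed.

(** Replacing [f] by [poly_act s f] changes nothing, and evaluating the latter amounts to pulling
    the graph back along the edge permutation. *)
Lemma evalg_invariant f p b : f \in invariant_ring -> p \in edge_perms ->
  evalg f (graph_of (act_graph p b)) = evalg f (graph_of b).
Proof.
move=> /forallP fI pP; have [s def_p] := edge_permsP _ pP.
rewrite -{2}(eqP (fI s)) evalg_poly_act; congr evalg.
apply/ffunP => e; have [i lt6 ->] := edge_nthP e.
have szp : size p = 6%N by rewrite (perm_size (edge_perms_perm pP)).
rewrite graph_of_nth // [RHS]ffunE edge_act_nth // -def_p graph_of_nth.
  by rewrite (nth_map 0%N) ?szp.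
have : nth 0%N p i \in p by rewrite mem_nth ?szp.
by rewrite (perm_mem (edge_perms_perm pP)) mem_iota.
Qed.

(** * Orbit sums and their values at graphs *)

Definition orbit_code (a : bitseq) := undup [seq act_mon p a | p <- edge_perms].

Lemma orbit_code_sub a : {subset orbit_code a <= codes}.
Proof. by move=> b; rewrite mem_undup => /mapP[p _ ->]; rewrite mem_bitseqs size_map. Qed.

(** Since [mon] is injective on codes, removing duplicates among codes and among polynomials leaves
    matching lists. *)
Lemma orbit_sum_mon a : orbit_sum (mon a) = \sum_(b <- orbit_code a) mon b.
Proof.
rewrite /orbit_sum -[RHS](big_map mon xpredT idfun); apply: perm_big.
apply: uniq_perm; rewrite ?undup_uniq //.
  rewrite map_inj_in_uniq ?undup_uniq // => b c /orbit_code_sub bP.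
  by move=> /orbit_code_sub; apply: mon_inj.
move=> f; rewrite mem_undup; apply/mapP/mapP => [[s _ ->] | [b]].
  rewrite poly_act_mon; exists (act_mon (edge_perm (perm_code s)) a) => //.
  rewrite mem_undup; apply: (map_f (act_mon^~ a)).
  by apply/edge_permsP; exists s.
rewrite mem_undup => /mapP[p /edge_permsP[s ->] ->] ->.
by exists s; rewrite ?mem_enum ?poly_act_mon.
Qed.

Lemma orbit_code_stable :
  all (fun a => all (fun p => perm_eq (map (act_mon p) (orbit_code a)) (orbit_code a))
    edge_perms) codes.
Proof. by vm_compute. Qed.

Lemma orbit_sum_invariant a : a \in codes -> orbit_sum (mon a) \in invariant_ring.
Proof.
move=> aP; apply/forallP => s; apply/eqP; rewrite orbit_sum_mon {1}/poly_act.
rewrite raddf_sum /=.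
under eq_bigr => b _ do rewrite -/(poly_act s _) poly_act_mon.
rewrite -(big_map _ xpredT mon); apply: perm_big.
by apply: (allP (allP orbit_code_stable a aP)); apply/edge_permsP; exists s.
Qed.

Definition ev (a b : bitseq) : bool := odd (count (subcode^~ b) (orbit_code a)).

Lemma F2_natr n : n%:R = (odd n)%:R :> 'F_2.
Proof. have two0 : 2%:R = 0 :> 'F_2 by apply: val_inj.
by rewrite -{1}[n]odd_double_half -mul2n natrD natrM two0 mul0r addr0. Qed.

Lemma F2_sum_bool (I : Type) (r : seq I) (P : pred I) :
  \sum_(i <- r) (P i)%:R = (odd (count P r))%:R :> 'F_2.
Proof.
rewrite -F2_natr -sum1_count natr_sum [RHS]big_mkcond.
by apply: eq_bigr => i _; case: (P i).
Qed.

Lemma evalg_orbit_sum a b : evalg (orbit_sum (mon a)) (graph_of b) = (ev a b)%:R.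
Proof.
rewrite orbit_sum_mon /evalg raddf_sum -F2_sum_bool.
by apply: eq_bigr => c _; apply: evalg_mon.
Qed.

(* The first code, in the order of [codes], of a graph isomorphic to [b]. *)
Definition rep (b : bitseq) : bitseq :=
  nth [::] codes (find (mem [seq act_graph p b | p <- edge_perms]) codes).

Definition reps : seq bitseq := undup [seq rep b | b <- codes].

Lemma evalg_rep f b : f \in invariant_ring -> b \in codes ->
  evalg f (graph_of (rep b)) = evalg f (graph_of b).
Proof.
(* This also shows that the search in [rep] always succeeds: its default [[::]] is too short to be
   an image of [b]. *)
have repP : all (fun b => rep b \in [seq act_graph p b | p <- edge_perms]) codes.
  by vm_compute.
by move=> fI /(allP repP)/mapP[p pP ->]; apply: evalg_invariant.
Qed.

Lemma repsP (v : graph) : exists2 r, r \in reps &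
  {in invariant_ring, forall f, evalg f v = evalg f (graph_of r)}.
Proof.
have [b bP ->] := graph_ofP v; exists (rep b); first by rewrite mem_undup map_f.
by move=> f fI; rewrite evalg_rep.
Qed.

(** Turns a computed duplicate check into injectivity on a list. *)
Lemma uniq_map_inj_in (T U : eqType) (h : T -> U) (s : seq T) :
  uniq (map h s) -> {in s &, injective h}.
Proof.
elim: s => //= x s IHs /andP[hx /IHs inj] y z.
rewrite !inE => /predU1P[->|ys] /predU1P[->|zs] // E; last exact: inj.
  by case/negP: hx; rewrite E map_f.
by case/negP: hx; rewrite -E map_f.
Qed.

(** * A computable test for separation *)

Definition orbit_poly (A : seq bitseq) : gpoly := \sum_(a <- A) orbit_sum (mon a).

Lemma orbit_poly1 a : orbit_poly [:: a] = orbit_sum (mon a).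
Proof. exact: big_seq1. Qed.

Lemma orbit_poly2 a c : orbit_poly [:: a; c] = orbit_sum (mon a) + orbit_sum (mon c).
Proof. by rewrite /orbit_poly big_cons big_seq1. Qed.

Lemma evalg_orbit_poly A b :
  evalg (orbit_poly A) (graph_of b) = (odd (count (ev^~ b) A))%:R.
Proof.
rewrite /orbit_poly /evalg raddf_sum -F2_sum_bool.
by apply: eq_bigr => a _; apply: evalg_orbit_sum.
Qed.

Lemma orbit_poly_invariant A : all (mem codes) A -> orbit_poly A \in invariant_ring.
Proof.
move=> /allP Acodes; apply/forallP => s; apply/eqP.
rewrite /orbit_poly /poly_act raddf_sum; apply: eq_big_seq => a /Acodes aP.
by apply/eqP; move: s; apply/forallP/orbit_sum_invariant.
Qed.

Definition signature (L : seq (seq bitseq)) (b : bitseq) : bitseq :=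
  [seq odd (count (ev^~ b) A) | A <- L].

(** If no polynomial coded by [L] distinguishes [u] and [v], their representatives have equal
    signatures and hence coincide; then every invariant agrees at [u] and [v]. *)
Lemma separating_criterion (S : {pred gpoly}) (L : seq (seq bitseq)) :
    {subset S <= invariant_ring} -> {subset map orbit_poly L <= S} ->
    uniq (map (signature L) reps) ->
  separating S.
Proof.
move=> SI LS /uniq_map_inj_in injL; split=> // u v [f fI fuv].
have [/hasP[A AL guv] | /hasPn agree] :=
    boolP (has (fun A => evalg (orbit_poly A) u != evalg (orbit_poly A) v) L).
  by exists (orbit_poly A) => //; apply/LS/map_f.
have [ru ruP Eu] := repsP u; have [rv rvP Ev] := repsP v.
case/negP: fuv; rewrite (Eu f fI) (Ev f fI); apply/eqP; congr (evalg f (graph_of _)).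
apply: (injL _ _ ruP rvP); apply/eq_in_map => A AL; apply: F2_bool_inj.
have gI := SI _ (LS _ (map_f orbit_poly AL)).
rewrite -!evalg_orbit_poly -(Eu _ gI) -(Ev _ gI).
exact/eqP/negPn/agree.
Qed.

(** * The ten generators and the four separating sets *)

Definition bits (l : seq (nat * nat)) : bitseq := [seq q \in l | q <- ends].

Definition m1 := bits [:: (0, 1)]%N.
Definition m2 := bits [:: (0, 1); (0, 2)]%N.
Definition m3 := bits [:: (0, 1); (2, 3)]%N.
Definition m4 := bits [:: (0, 1); (0, 2); (0, 3)]%N.
Definition m5 := bits [:: (0, 1); (0, 2); (1, 2)]%N.
Definition m6 := bits [:: (0, 1); (0, 2); (1, 3)]%N.
Definition m7 := bits [:: (0, 1); (0, 2); (0, 3); (1, 3)]%N.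
Definition m8 := bits [:: (0, 1); (0, 2); (1, 3); (2, 3)]%N.
Definition m9 := bits [:: (0, 1); (0, 2); (0, 3); (1, 2); (1, 3)]%N.
Definition m10 := bits ends.

Definition gens : seq bitseq := [:: m1; m2; m3; m4; m5; m6; m7; m8; m9; m10].

Lemma monE a : mon a =
  x12 ^+ nth false a 0 * (x13 ^+ nth false a 1 * (x14 ^+ nth false a 2 *
  (x23 ^+ nth false a 3 * (x24 ^+ nth false a 4 * x34 ^+ nth false a 5)))).
Proof. by rewrite /mon !big_cons big_nil mulr1. Qed.

Lemma f1E : f1 = orbit_sum (mon m1).
Proof. by rewrite monE /= !(expr0, expr1, mul1r, mulr1). Qed.
Lemma f2E : f2 = orbit_sum (mon m2).
Proof. by rewrite monE /= !(expr0, expr1, mul1r, mulr1). Qed.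
Lemma f3E : f3 = orbit_sum (mon m3).
Proof. by rewrite monE /= !(expr0, expr1, mul1r, mulr1). Qed.
Lemma f4E : f4 = orbit_sum (mon m4).
Proof. by rewrite monE /= !(expr0, expr1, mul1r, mulr1, mulrA). Qed.
Lemma f5E : f5 = orbit_sum (mon m5).
Proof. by rewrite monE /= !(expr0, expr1, mul1r, mulr1, mulrA). Qed.
Lemma f6E : f6 = orbit_sum (mon m6).
Proof. by rewrite monE /= !(expr0, expr1, mul1r, mulr1, mulrA). Qed.
Lemma f7E : f7 = orbit_sum (mon m7).
Proof. by rewrite monE /= !(expr0, expr1, mul1r, mulr1, mulrA). Qed.
Lemma f8E : f8 = orbit_sum (mon m8).
Proof. by rewrite monE /= !(expr0, expr1, mul1r, mulr1, mulrA). Qed.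
Lemma f9E : f9 = orbit_sum (mon m9).
Proof. by rewrite monE /= !(expr0, expr1, mul1r, mulr1, mulrA). Qed.
Lemma f10E : f10 = orbit_sum (mon m10).
Proof. by rewrite monE /= !(expr0, expr1, mul1r, mulr1, mulrA). Qed.

Lemma gens_polyE :
  [seq orbit_sum (mon a) | a <- gens] = [:: f1; f2; f3; f4; f5; f6; f7; f8; f9; f10].
Proof. by rewrite f1E f2E f3E f4E f5E f6E f7E f8E f9E f10E. Qed.

(** The [foldl] is convertible to the nested unions behind the notation for explicit finite sets, so
    membership reduces to membership in a list. *)
Lemma mem_fset_seq (K : choiceType) (x : K) (s : seq K) :
  foldl (fun A a => A `|` [fset a])%fset [fset x]%fset s =i x :: s.
Proof.
suff H (A : {fset K}) y :
    (y \in foldl (fun A a => A `|` [fset a])%fset A s) = (y \in A) || (y \in s).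
  by move=> y; rewrite H in_fset1.
elim: s A => [|a s IHs] A /=; first by rewrite orbF.
by rewrite IHs in_fsetU in_fset1 in_cons orbA.
Qed.

(* Inner lists are sums of orbit sums: [L3] and [L4] encode S3 and S4. *)
Definition L1 := [:: [:: m1]; [:: m2]; [:: m3]; [:: m4]; [:: m8]].
Definition L2 := [:: [:: m1]; [:: m2]; [:: m3]; [:: m5]; [:: m8]].
Definition L3 := [:: [:: m1]; [:: m2]; [:: m3]; [:: m4; m8]].
Definition L4 := [:: [:: m1]; [:: m2]; [:: m3]; [:: m5; m8]].

Lemma mem_M : M =i [seq orbit_sum (mon a) | a <- gens].
Proof.
rewrite gens_polyE.
exact: (mem_fset_seq f1 [:: f2; f3; f4; f5; f6; f7; f8; f9; f10]).
Qed.

Lemma mem_S1 : S1 =i map orbit_poly L1.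
Proof.
rewrite /= !orbit_poly1 -f1E -f2E -f3E -f4E -f8E.
exact: (mem_fset_seq f1 [:: f2; f3; f4; f8]).
Qed.

Lemma mem_S2 : S2 =i map orbit_poly L2.
Proof.
rewrite /= !orbit_poly1 -f1E -f2E -f3E -f5E -f8E.
exact: (mem_fset_seq f1 [:: f2; f3; f5; f8]).
Qed.

Lemma mem_S3 : S3 =i map orbit_poly L3.
Proof.
rewrite /= !orbit_poly1 orbit_poly2 -f1E -f2E -f3E -f4E -f8E.
exact: (mem_fset_seq f1 [:: f2; f3; f4 + f8]).
Qed.

Lemma mem_S4 : S4 =i map orbit_poly L4.
Proof.
rewrite /= !orbit_poly1 orbit_poly2 -f1E -f2E -f3E -f5E -f8E.
exact: (mem_fset_seq f1 [:: f2; f3; f5 + f8]).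
Qed.

Lemma M_invariant : {subset M <= invariant_ring}.
Proof.
move=> f; rewrite mem_M => /mapP[a aP ->]; apply: orbit_sum_invariant.
have: all (mem codes) gens by vm_compute.
by move/allP; apply.
Qed.

Lemma separating_fset (S : {fset gpoly}) (L : seq (seq bitseq)) :
    S =i map orbit_poly L -> all (all (mem codes)) L ->
    uniq (map (signature L) reps) ->
  separating (mem S).
Proof.
move=> SL /allP Lcodes; apply: separating_criterion => f; last by rewrite -SL.
rewrite -[f \in _]/(f \in S) SL => /mapP[A AL ->].
by apply: orbit_poly_invariant; apply: Lcodes.
Qed.

Lemma S1_separating : separating (mem S1).
Proof. by apply: (separating_fset mem_S1); vm_compute. Qed.

Lemma S2_separating : separating (mem S2).
Proof. by apply: (separating_fset mem_S2); vm_compute. Qed.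

Lemma S3_separating : separating (mem S3).
Proof. by apply: (separating_fset mem_S3); vm_compute. Qed.

Lemma S4_separating : separating (mem S4).
Proof. by apply: (separating_fset mem_S4); vm_compute. Qed.

(** * Minimal separating subsets of [M] *)

Lemma separating_hit (S : {fset gpoly}) (u v : bitseq) (D : seq bitseq) :
    (S `<=` M)%fset -> separating (mem S) ->
    [seq a <- gens | ev a u != ev a v] = D -> D != [::] ->
  has (fun a => orbit_sum (mon a) \in S) D.
Proof.
move=> SM [_ Ssep] <-; rewrite -has_filter => /hasP[a agens auv].
have evalgN c : (evalg (orbit_sum (mon c)) (graph_of u)
                 != evalg (orbit_sum (mon c)) (graph_of v)) = (ev c u != ev c v).
  by rewrite !evalg_orbit_sum; case: (ev c u) (ev c v) => [] [].
have [|f fS fuv] := Ssep (graph_of u) (graph_of v).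
  exists (orbit_sum (mon a)); last by rewrite evalgN.
  by apply/M_invariant; rewrite mem_M; apply: (map_f (fun c => orbit_sum (mon c))).
(* The separating element of [S] lies in [M], so it is the orbit sum of some generator whose values
   at [u] and [v] differ. *)
have := fsubsetP SM f fS; rewrite mem_M => /mapP[c cgens fE].
apply/hasP; exists c; last by rewrite -fE.
by rewrite mem_filter cgens -evalgN -fE fuv.
Qed.

Lemma separating_subset_M (S : {fset gpoly}) :
    (S `<=` M)%fset -> separating (mem S) ->
  (S1 `<=` S)%fset \/ (S2 `<=` S)%fset.
Proof.
move=> SM Ssep; have hit := separating_hit SM Ssep.
have S_1 : orbit_sum (mon m1) \in S.
  (* [orbF] is undone because [has] on a singleton computes to a disjunction with [false]. *)
  by rewrite -[_ \in S]orbF; apply: (hit (bits [::]) m1 [:: m1]); vm_compute.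
have S_2 : orbit_sum (mon m2) \in S.
  by rewrite -[_ \in S]orbF; apply: (hit (bits [::]) m2 [:: m2]); vm_compute.
have S_3 : orbit_sum (mon m3) \in S.
  by rewrite -[_ \in S]orbF; apply: (hit (bits [::]) m3 [:: m3]); vm_compute.
have S_8 : orbit_sum (mon m8) \in S.
  (* The 4-cycle contains 4 edges, 4 adjacent pairs, 2 opposite pairs and 4 paths of three edges,
     all even numbers, so only [f8] distinguishes it from the empty graph. *)
  by rewrite -[_ \in S]orbF; apply: (hit (bits [::]) m8 [:: m8]); vm_compute.
(* The star and the triangle both have three edges, three adjacent pairs and no disjoint pair, so
   they differ only in [f4] and [f5]. *)
have: has (fun a => orbit_sum (mon a) \in S) [:: m4; m5].
  by apply: (hit m4 m5); vm_compute.
move=> /or3P[S_4 | S_5 | //]; [left | right]; apply/fsubsetP => f.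
  have /allP SL1 : all (fun A => orbit_poly A \in S) L1.
    rewrite /= !orbit_poly1; apply/and5P; split.
    - exact: S_1.
    - exact: S_2.
    - exact: S_3.
    - exact: S_4.
    - by rewrite andbT; exact: S_8.
  by rewrite mem_S1 => /mapP[A /SL1 AS ->].
have /allP SL2 : all (fun A => orbit_poly A \in S) L2.
  rewrite /= !orbit_poly1; apply/and5P; split.
    - exact: S_1.
    - exact: S_2.
    - exact: S_3.
    - exact: S_5.
    - by rewrite andbT; exact: S_8.
by rewrite mem_S2 => /mapP[A /SL2 AS ->].
Qed.

Lemma S1_sub_M : (S1 `<=` M)%fset.
Proof.
apply/fsubsetP => f fS; rewrite mem_M; move: fS; rewrite mem_S1 => /mapP[A AL ->].
have: all (fun A => (size A == 1%N) && (head [::] A \in gens)) L1 by vm_compute.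
move=> /allP/(_ A AL); case: A {AL} => [|a []] // /andP[_ agens].
by rewrite orbit_poly1; apply: (map_f (fun c => orbit_sum (mon c))).
Qed.

Lemma S2_sub_M : (S2 `<=` M)%fset.
Proof.
apply/fsubsetP => f fS; rewrite mem_M; move: fS; rewrite mem_S2 => /mapP[A AL ->].
have: all (fun A => (size A == 1%N) && (head [::] A \in gens)) L2 by vm_compute.
move=> /allP/(_ A AL); case: A {AL} => [|a []] // /andP[_ agens].
by rewrite orbit_poly1; apply: (map_f (fun c => orbit_sum (mon c))).
Qed.

(** Polynomials with different values at some graph are distinct, which leaves a finite
    computation. *)
Lemma orbit_poly_notin A L :
    all (fun B => has (fun b => odd (count (ev^~ b) A) != odd (count (ev^~ b) B))
      codes) L ->
  orbit_poly A \notin map orbit_poly L.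
Proof.
move=> /allP neqL; apply/mapP => -[B /neqL/hasP[b _ /eqP neq] E].
by apply/neq/F2_bool_inj; rewrite -!evalg_orbit_poly E.
Qed.

Lemma S1_not_sub_S2 : ~ (S1 `<=` S2)%fset.
Proof.
move/fsubsetP/(_ (orbit_poly [:: m4])) => S12.
have /negP[] : orbit_poly [:: m4] \notin map orbit_poly L2.
  by apply: orbit_poly_notin; vm_compute.
rewrite -mem_S2; apply: S12; rewrite mem_S1.
by apply: map_f; vm_compute.
Qed.

Lemma S2_not_sub_S1 : ~ (S2 `<=` S1)%fset.
Proof.
move/fsubsetP/(_ (orbit_poly [:: m5])) => S21.
have /negP[] : orbit_poly [:: m5] \notin map orbit_poly L1.
  by apply: orbit_poly_notin; vm_compute.
rewrite -mem_S1; apply: S21; rewrite mem_S2.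
by apply: map_f; vm_compute.
Qed.

Lemma minimal_separating_subset_M (S : {fset gpoly}) :
  minimal_separating_subset M S <-> S = S1 \/ S = S2.
Proof.
split.
  case=> SM Ssep minS.
  have [S1S | S2S] := separating_subset_M SM Ssep; [left | right].
    apply/eqP; apply: contraT => neq; case: (minS S1); last exact: S1_separating.
    by rewrite fproperEneq S1S eq_sym neq.
  apply/eqP; apply: contraT => neq; case: (minS S2); last exact: S2_separating.
  by rewrite fproperEneq S2S eq_sym neq.
case=> ->; split; [exact: S1_sub_M | exact: S1_separating | |
                   exact: S2_sub_M | exact: S2_separating |] => T TS Tsep.
  (* A separating proper subset would again contain [S1] or [S2]: one contradicts properness, the
     other the incomparability of [S1] and [S2]. *)
  have TM := fsubset_trans (fproper_sub TS) S1_sub_M.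
  have [S1T | S2T] := separating_subset_M TM Tsep.
    by move: TS; rewrite fproperE S1T andbF.
  exact: S2_not_sub_S1 (fsubset_trans S2T (fproper_sub TS)).
have TM := fsubset_trans (fproper_sub TS) S2_sub_M.
have [S1T | S2T] := separating_subset_M TM Tsep.
  exact: S1_not_sub_S2 (fsubset_trans S1T (fproper_sub TS)).
by move: TS; rewrite fproperE S2T andbF.
Qed.

(** * The lower bound on the size of a separating set *)

Lemma reps_separated : {in reps &, forall r r',
  (forall f, f \in invariant_ring -> evalg f (graph_of r) = evalg f (graph_of r')) ->
  r = r'}.
Proof.
have /uniq_map_inj_in injL : uniq (map (signature L1) reps) by vm_compute.
move=> r r' rP r'P agree; apply: (injL _ _ rP r'P); apply/eq_in_map => A AL.
apply: F2_bool_inj; rewrite -!evalg_orbit_poly; apply: agree.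
apply: orbit_poly_invariant; move: A AL; apply/allP; vm_compute; reflexivity.
Qed.

Lemma size_uniq_leq_card (T : finType) (s : seq T) : uniq s -> (size s <= #|T|)%N.
Proof. by move=> /card_uniqP <-; apply: max_card. Qed.

Lemma separating_card (T : {fset gpoly}) : separating (mem T) -> (4 <= #|` T|)%N.
Proof.
move=> [_ Tsep].
(* All values of [T] at a representative; since [T] separates, this vector determines the
   representative. *)
pose h r := [tuple of [seq evalg f (graph_of r) | f <- in_tuple (enum_fset T)]].
have inj_h : {in reps &, injective h}.
  move=> r r' rP r'P /(congr1 val)/eq_in_map eqh.
  apply: (reps_separated rP r'P) => f fI.
  apply/eqP; apply: contraT => fneq.
  have [|g gT /negP[]] := Tsep (graph_of r) (graph_of r'); first by exists f.
  exact/eqP/eqh.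
have sz_reps : size reps = 11%N by vm_compute.
have uniq_h : uniq (map h reps) by rewrite (map_inj_in_uniq inj_h) undup_uniq.
have := size_uniq_leq_card uniq_h.
rewrite size_map sz_reps card_tuple (card_Fp (isT : prime 2)).
(* For sizes 0 to 3 the bound [11 <= 2 ^ n] is false. *)
by move: (size _) => n; case: n => [|[|[|[|n]]]].
Qed.

(** The list [s] bounds the cardinal of [S] by 4, which meets the lower bound of
    [separating_card]. *)
Lemma smallest_separatingP (S : {fset gpoly}) (s : seq gpoly) :
  separating (mem S) -> S =i s -> (size s <= 4)%N -> smallest_separating S.
Proof.
move=> Ssep Ss s4; split=> // T /separating_card; apply: leq_trans.
apply: leq_trans s4; apply: uniq_leq_size (fset_uniq S) _ => f fS.
by rewrite -Ss.
Qed.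

Lemma S3_smallest : smallest_separating S3.
Proof. by apply: (smallest_separatingP S3_separating mem_S3); rewrite size_map. Qed.

Lemma S4_smallest : smallest_separating S4.
Proof. by apply: (smallest_separatingP S4_separating mem_S4); rewrite size_map. Qed.

(** * Degrees and the value of the separating Noether number *)

Lemma prod_xvar_homog (r : seq nat) (y : nat -> bool) :
  \prod_(i <- r) xvar (edge_nth i) ^+ y i \is (count y r).-homog.
Proof.
elim: r => [|i r IHr]; first by rewrite big_nil; apply: dhomog1.
rewrite big_cons /=; apply: dhomogM => //.
case: (y i); last by rewrite expr0 dhomog1.
by rewrite expr1 /xvar dhomogX /= mdeg1.
Qed.

Definition degree (a : bitseq) : nat := count (nth false a) (iota 0 6).

Lemma orbit_sum_homog a : all (fun b => degree b == degree a) (orbit_code a) ->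
  orbit_sum (mon a) \is (degree a).-homog.
Proof.
move=> /allP deg_a; rewrite orbit_sum_mon big_seq; apply: rpred_sum => b /deg_a/eqP <-.
exact: prod_xvar_homog.
Qed.

Lemma S1_homog f : f \in S1 -> f \in homog_invariant_le 4.
Proof.
move=> fS; have fI : f \in invariant_ring by have [-> //] := S1_separating.
rewrite inE fI; move: fS {fI}; rewrite mem_S1 => /mapP[A AL ->].
have: all (fun A => if A is [:: a]
  then (degree a < 5)%N && all (fun b => degree b == degree a) (orbit_code a)
  else false) L1 by vm_compute.
move=> /allP/(_ A AL); case: A {AL} => [|a []] // /andP[deg4 deg_a].
by apply/existsP; exists (Ordinal deg4); rewrite orbit_poly1; apply: orbit_sum_homog.
Qed.

(** Transports products and sums over the variables, numbered by the opaque [enum_rank], to the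
    explicit ranks 0 to 5. *)
Lemma big_edges (R : Type) (idx : R) (op : Monoid.com_law idx) (F : 'I_#|{: edge}| -> R) :
  \big[op/idx]_i F i = \big[op/idx]_(i <- iota 0 6) F (enum_rank (edge_nth i)).
Proof.
rewrite (reindex_onto enum_rank enum_val) /=; last by move=> i _; apply: enum_valK.
under eq_bigl => e do rewrite enum_rankK eqxx.
rewrite -[RHS](big_map edge_nth xpredT (fun e => F (enum_rank e))).
apply: perm_big; apply: uniq_perm; rewrite ?index_enum_uniq ?uniq_edges //.
by move=> e; rewrite mem_index_enum mem_edges.
Qed.

Definition support (m : 'X_{1..#|{: edge}|}) : bitseq :=
  [seq m (enum_rank (edge_nth i)) != 0%N | i <- iota 0 6].

Lemma nth_support m i : (i < 6)%N ->
  nth false (support m) i = (m (enum_rank (edge_nth i)) != 0%N).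
Proof. by move=> lt6; rewrite (nth_map 0%N) ?size_iota // nth_iota. Qed.

Lemma degree_support m : (degree (support m) <= mdeg m)%N.
Proof.
rewrite mdegE big_edges /degree -sum1_count big_mkcond big_seq [leqRHS]big_seq.
apply: leq_sum => i; rewrite mem_iota => lt6; rewrite nth_support //.
by case: (m _).
Qed.

(** Positive powers of an element of ['F_2] equal that element, so only the support of the exponent
    vector matters. *)
Lemma mevalX_graph m b :
  'X_[m].@[fun i => graph_of b (enum_val i)] = (subcode (support m) b)%:R.
Proof.
rewrite mevalX big_edges -prod_bool_exp; apply: eq_big_seq => i.
rewrite mem_iota => lt6; rewrite enum_rankK graph_of_nth // nth_support //.
case: (m _) => [|k] //=; case: (nth _ _ _); rewrite ?expr1n //.
by rewrite expr0n expr1.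
Qed.

(* A monomial of degree at most 3 misses an edge of the 4-cycle, and switching
   that edge pairs off the 16 subgraphs of the cycle. *)
Lemma low_degree_cycle f d : f \in invariant_ring -> f \is d.-homog -> (d <= 3)%N ->
  evalg f (graph_of (bits [::])) = evalg f (graph_of m8).
Proof.
move=> fI fhom d3; pose W := [seq b <- codes | subcode b m8].
have sumW : \sum_(b <- W) evalg f (graph_of b) = 0.
  (* The count is [2 ^ (4 - degree a)] when [a] lies in the cycle and 0 otherwise. *)
  have even_sub : all (fun a => (degree a <= 3)%N ==> ~~ odd (count (subcode a) W)) codes.
    by vm_compute.
  under eq_bigr => b _ do rewrite /evalg {1}[f]mpolyE raddf_sum.
  rewrite exchange_big big_seq big1 // => m mf /=.
  under eq_bigr => b _ do rewrite mevalZ mevalX_graph.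
  rewrite -mulr_sumr F2_sum_bool.
  have sm : support m \in codes by rewrite mem_bitseqs size_map.
  have := allP even_sub _ sm; rewrite (leq_trans (degree_support m)); last first.
    by rewrite (dhomog_mf fhom mf).
  by move=> /negPf ->; rewrite mulr0.
(* Half of the 14 proper nonempty subgraphs of the cycle, by class: 2 of 4 edges, 2 of 4 adjacent
   pairs, 1 of 2 opposite pairs, 2 of 4 paths. *)
pose proper := map rep [:: bits [:: (0, 1)]; bits [:: (0, 1)];
  bits [:: (0, 1); (0, 2)]; bits [:: (0, 1); (0, 2)]; bits [:: (0, 1); (2, 3)];
  bits [:: (0, 1); (0, 2); (1, 3)]; bits [:: (0, 1); (0, 2); (1, 3)]]%N.
have classes : perm_eq (map rep W) ([:: rep (bits [::]); rep m8] ++ proper ++ proper).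
  by vm_compute.
have F2_double (x : 'F_2) : x + x = 0.
  by case: x => [[|[|//]] lt2]; apply: val_inj.
have F2_addr_eq0 (x y : 'F_2) : x + y = 0 -> x = y.
  by move=> xy; rewrite -[x]addr0 -(F2_double y) addrA xy add0r.
have cW b : b \in W -> b \in codes by rewrite mem_filter => /andP[].
move: sumW; rewrite big_seq.
under eq_bigr => b /cW bc do rewrite -(evalg_rep fI bc).
rewrite -big_seq -(big_map rep xpredT (fun b => evalg f (graph_of b))).
(* The two copies of [proper] cancel in characteristic 2, leaving the values at the empty graph and
   at the cycle. *)
rewrite (perm_big _ classes) big_cat big_cat /= F2_double addr0 big_cons big_seq1.
have c0 : bits [::] \in codes by vm_compute.
have c8 : m8 \in codes by vm_compute.
move=> E; apply: etrans (esym (evalg_rep fI c0)) _.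
apply: etrans (evalg_rep fI c8); exact: F2_addr_eq0 E.
Qed.

Lemma beta_sep : is_beta_sep 4.
Proof.
have [_ S1sep] := S1_separating; split.
  split=> [f /andP[] // | u v /S1sep[f fS fuv]].
  by exists f => //; apply: S1_homog.
move=> b [_ bsep]; rewrite leqNgt; apply/negP => b3.
have [|f /andP[fI /existsP[d fhom]] /negP[]] :=
    bsep (graph_of (bits [::])) (graph_of m8).
  exists (orbit_sum (mon m8)); first by apply: orbit_sum_invariant; vm_compute.
  by rewrite !evalg_orbit_sum; vm_compute.
apply/eqP/(low_degree_cycle fI fhom).
by rewrite -ltnS (leq_trans (ltn_ord d)).
Qed.

Theorem theorem3p1 :
  [/\ {subset M <= invariant_ring} /\ f10 = x12 * x13 * x14 * x23 * x24 * x34,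
      forall S : {fset gpoly}, minimal_separating_subset M S <-> S = S1 \/ S = S2,
      smallest_separating S3,
      smallest_separating S4
    & is_beta_sep 4].
Proof.
split; [split | exact: minimal_separating_subset_M | exact: S3_smallest
       | exact: S4_smallest | exact: beta_sep].
  exact: M_invariant.
rewrite f10E orbit_sum_mon.
(* The full edge set is fixed by every permutation. *)
have -> : orbit_code m10 = [:: m10] by vm_compute.
by rewrite big_seq1 monE /= !(expr0, expr1, mul1r, mulr1, mulrA).
Qed.
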